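(* Let an integer $n\ge 1$ be given. Then for every integer $e\ge 1$ there are an integer $k=k(n,e)\ge 1$ and real numbers $\epsilon=\epsilon(n,e)>0$ and $c=c(n,e)>0$ such that: if $X\subseteq\mathbb{R}^n$ has a strong $k$-parametrization, then for all real $T\ge 1$ at most $cT^{\epsilon}$ many hypersurfaces in $\mathbb{R}^n$ of degree $\le e$ are enough to cover $X(\mathbb{Q},T)$; and moreover these can be chosen with $\epsilon(n,e)\to 0$ as $e\to\infty$.
   Context: For $q=a/b\in\mathbb{Q}$ with $a,b$ coprime integers, $b\neq 0$, put $\mathrm{H}(q)=\max(|a|,|b|)$, and for $a\in\mathbb{Q}^n$ put $\mathrm{H}(a)=\max_i\mathrm{H}(a_i)$. For $X\subseteq\mathbb{R}^n$ and real $T\ge1$: $X(\mathbb{Q},T)=\{a\in X\cap\mathbb{Q}^n:\mathrm{H}(a)\le T\}$. On $\mathbb{R}^n$ we use the norm $|a|=\max\{|a_1|,\dots,|a_n|\}$. For a $C^k$-map $f:U\to\mathbb{R}^n$ on an open $U\subseteq\mathbb{R}^m$ and $\alpha\in\mathbb{N}^m$ with $|\alpha|:=\alpha_1+\cdots+\alpha_m\le k$, $f^{(\alpha)}$ denotes the (componentwise) partial derivative of order $\alpha$. ($\mathbb N=\{0,1,2,\dots\}$; $m=0$ is allowed, where $\mathbb{R}^0$ is a point, every map on it is $C^k$, and $f^{(\alpha)}=f$.) For $k,n\ge1$, a strong $k$-parametrization of $X\subseteq\mathbb{R}^n$ is a $C^k$-map $f:(0,1)^m\to\mathbb{R}^n$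 with $m<n$ and image $X$ such that $|f^{(\alpha)}(a)|\le 1$ for all $\alpha\in\mathbb{N}^m$ with $|\alpha|\le k$ and all $a\in(0,1)^m$. A hypersurface in $\mathbb{R}^n$ of degree $\le e$ is the zero set in $\mathbb{R}^n$ of a nonzero polynomial in $n$ variables over $\mathbb{R}$ of total degree $\le e$. *)

(* Defs.v *)
From HB Require Import structures.
From mathcomp Require Import all_boot all_order all_algebra.
(* The notations of mpoly clash with those of mathcomp-analysis. *)
From mathcomp Require Import -(notations) mpoly.
From mathcomp Require Import all_classical all_reals all_analysis.

Set Implicit Arguments.
Unset Strict Implicit.
Unset Printing Implicit Defensive.

Import Order.TTheory GRing.Theory Num.Theory.
Import numFieldNormedType.Exports.

Local Open Scope classical_set_scope.
Local Open Scope ring_scope.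

Definition height (q : rat) : nat := maxn `|numq q|%N `|denq q|%N.

Definition vheight n (q : 'rV[rat]_n) : nat := \max_(i < n) height (q ord0 i).

Definition ratpoints (R : realType) n (X : set 'rV[R]_n) (T : R) :
    set 'rV[R]_n :=
  X `&` [set a | exists q : 'rV[rat]_n,
           a = map_mx (@ratr R) q /\ (vheight q)%:R <= T].

Definition ocube (R : realType) m : set 'rV[R]_m :=
  [set x : 'rV[R]_m | forall i, 0 < x 0 i < 1].

Definition partial (R : realType) m n (i : 'I_m) (f : 'rV[R]_m -> 'rV[R]_n) :
    'rV[R]_m -> 'rV[R]_n :=
  fun x => 'D_(delta_mx 0 i) f x.

(* For U open: all iterated partial derivatives of f of order <= k exist and
   are continuous on U. Functions are total, but only the values of f on U
   matter, because the notions involved are local. *)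
Fixpoint Ck (R : realType) m n (k : nat) (U : set 'rV[R]_m)
    (f : 'rV[R]_m -> 'rV[R]_n) : Prop :=
  (forall x, U x -> {for x, continuous f}) /\
  match k with
  | 0%N => True
  | k'.+1 => forall i : 'I_m,
      (forall x, U x -> derivable f x (delta_mx 0 i)) /\ Ck k' U (partial i f)
  end.

Definition mindex_order m (alpha : 'I_m -> nat) : nat :=
  (\sum_(i < m) alpha i)%N.

(* The partial derivatives are taken in a fixed order, which is immaterial for
   a C^k map when |alpha| <= k. *)
Definition mpartial (R : realType) m n (alpha : 'I_m -> nat)
    (f : 'rV[R]_m -> 'rV[R]_n) : 'rV[R]_m -> 'rV[R]_n :=
  foldr (fun i g => iter (alpha i) (partial i) g) f (enum 'I_m).

(* The norm on 'rV[R]_n is the maximum of the absolute values of the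
   coordinates. *)
Definition strong_parametrization (R : realType) n (k m : nat)
    (X : set 'rV[R]_n) (f : 'rV[R]_m -> 'rV[R]_n) : Prop :=
  [/\ (m < n)%N,
      Ck k (@ocube R m) f,
      f @` (@ocube R m) = X &
      forall alpha : 'I_m -> nat, (mindex_order alpha <= k)%N ->
        forall a, ocube a -> `|mpartial alpha f a| <= 1].

Definition has_strong_parametrization (R : realType) n (k : nat)
    (X : set 'rV[R]_n) : Prop :=
  exists (m : nat) (f : 'rV[R]_m -> 'rV[R]_n), strong_parametrization k X f.

(* msize p is 1 + the total degree of p when p != 0. *)
Definition hypersurface (R : realType) n (e : nat) (S : set 'rV[R]_n) : Prop :=
  exists p : mpoly n R,
    [/\ p != 0, (mpoly.msize p <= e.+1)%N &
        S = [set x : 'rV[R]_n | meval (fun i => x 0 i) p = 0]].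

(* Main.v *)
Require Import Defs.
From HB Require Import structures.
From mathcomp Require Import all_boot all_order all_algebra.
From mathcomp Require Import -(notations) mpoly.
From mathcomp Require Import ring lra zify.
From mathcomp Require Import all_classical all_reals all_analysis.

Set Implicit Arguments.
Unset Strict Implicit.
Unset Printing Implicit Defensive.

Import Order.TTheory GRing.Theory Num.Theory.
Import numFieldNormedType.Exports.

Local Open Scope classical_set_scope.
Local Open Scope ring_scope.

(** Proof idea. Fix an integer w >= 1 and put s = 2 w^n and k = s w. Let
    f : (0,1)^m -> R^n be a strong k-parametrization of X, with m < n. There are
    D = s^n monomials in n variables with all exponents < s (their degree is
    at most n(s-1)), and A = k^m monomials in m variables with all exponents
    < k. As m <= n-1, the choice of s and k gives 2A <= D: this is where the
    drop of dimension is used.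

    Cut (0,1)^m into M^m cells of radius r = 1/M. On a cell, Taylor's formula
    shows that each coordinate of f, hence each of the D monomials evaluated at
    f, is a combination of the A monomials in t - a, a being the center of the
    cell, with coefficients bounded independently of the cell and of f, up to
    an error O(r^k) (lemmas jet_taylor, jet_mul, jet_monom). As 2A <= D, the
    pigeonhole principle (small_values_pigeonhole) provides a nonzero integer
    vector z with entries at most H for which the A coefficients of the
    corresponding combination of monomials are O(1/H). So the polynomial P with
    coefficients z satisfies |P(f(t))| = O(1/H + H r^k) on the whole cell. If
    f(t) is a rational point of height at most T, then P(f(t)) is a rational
    number with a denominator at most T^(ns), so it vanishes as soon as
    |P(f(t))| < T^(-ns) (small_rational_value_eq0). It suffices to take H of
    the order of T^(ns) and M^k of the order of T^(2ns), that is, M of the order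
    of T^(2n/w), since ns/k = n/w. One hypersurface for each cell makes
    M^m = O(T^(2n^2/w)) hypersurfaces of degree at most n(s-1)
    (parametrized_cover).

    Given e, take w to be the largest integer with 2 n w^n <= e, so that these
    hypersurfaces have degree at most e; w tends to infinity with e, and so
    epsilon = 2n^2/w tends to 0. When e is too small for any w >= 1, the
    hyperplanes x_1 = p/q with |p|, |q| <= T, which are O(T^2) in number,
    cover all rational points of height at most T (hyperplanes_cover). *)

(** * Taylor's formula in one variable *)

Lemma is_derive_expB (R : realType) (x0 : R) (j : nat) (c y : R) :
  is_derive y 1 (fun y => c * (y - x0) ^+ j.+1 / j.+1`!%:R)
    (c * (y - x0) ^+ j / j`!%:R).
Proof.
have j1 : j.+1%:R != 0 :> R by rewrite pnatr_eq0.
have j2 : j`!%:R != 0 :> R by rewrite pnatr_eq0 -lt0n fact_gt0.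
pose p : {poly R} := (c / j.+1`!%:R) *: ('X - x0%:P) ^+ j.+1.
have -> : (fun y => c * (y - x0) ^+ j.+1 / j.+1`!%:R) = horner p.
  by apply/funext => z; rewrite /p !hornerE mulrAC.
have -> : c * (y - x0) ^+ j / j`!%:R = (p^`()).[y].
  rewrite /p derivZ deriv_exp derivB derivX derivC subr0 ?mul1r.
  rewrite hornerZ hornerMn !hornerE -mulr_natr factS natrM.
  by field; rewrite j2 addrC natr1 j1.
exact: is_derive_poly.
Qed.

(** The functions phi j are the successive derivatives of phi 0. The error of
    the expansion of phi 0 has as its derivative the error of the expansion of
    phi 1 with one term less, so the mean value theorem gains one factor
    |x - x0| at each step of an induction on k. *)
Lemma taylor_bound (R : realType) (lo hi : R) (k : nat) :
  forall phi : nat -> R -> R,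
  (forall j x, (j < k)%N -> x \in `]lo, hi[ ->
     is_derive x 1 (phi j) (phi j.+1 x)) ->
  (forall x, x \in `]lo, hi[ -> `|phi k x| <= 1) ->
  forall x0 x, x0 \in `]lo, hi[ -> x \in `]lo, hi[ ->
  `|phi 0%N x - \sum_(j < k) phi j x0 * (x - x0) ^+ j / j`!%:R| <= `|x - x0| ^+ k.
Proof.
elim: k => [|k IH] phi dphi bphi x0 x x0I xI.
  by rewrite big_ord0 subr0 expr0 bphi.
set E' := fun y => phi 1%N y - \sum_(j < k) phi j.+1 x0 * (y - x0) ^+ j / j`!%:R.
have {}IH y : y \in `]lo, hi[ -> `|E' y| <= `|y - x0| ^+ k.
  exact: (IH (fun j => phi j.+1) (fun j x jk => dphi j.+1 x jk) bphi x0 y x0I).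
set E := fun y => phi 0%N y -
  \sum_(j < k.+1) phi j x0 * (y - x0) ^+ j / j`!%:R.
(* The error term vanishes at x0 and its derivative is E', so the mean value
   theorem on the segment between x0 and x gives the bound. *)
have E0 : E x0 = 0.
  rewrite /E big_ord_recl expr0 fact0 divr1 mulr1 big1 ?addr0 ?subrr // => i _.
  by rewrite expr0n /= mulr0 mul0r.
have dE y : y \in `]lo, hi[ -> is_derive y 1 E (E' y).
  move=> yI.
  have -> : E = phi 0%N \- (cst (phi 0%N x0) \+
     \sum_(j < k) (fun y => phi j.+1 x0 * (y - x0) ^+ j.+1 / j.+1`!%:R)).
    apply/funext => z; rewrite /E /= fct_sumE big_ord_recl.
    by rewrite expr0 fact0 divr1 mulr1.
  rewrite /E' -[X in _ - X]add0r.
  apply: is_deriveB; first exact: dphi.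
  apply: is_deriveD.
  have H (j : 'I_k) := is_derive_expB x0 j (phi j.+1 x0) y.
  exact: is_derive_sum.
rewrite -[X in `|X|]/(E x).
clearbody E E' => {dphi bphi}.
have EI a b : a \in `]lo, hi[ -> b \in `]lo, hi[ -> a < b ->
    exists2 c, a < c < b & E b - E a = E' c * (b - a).
  move=> aI bI ab.
  have sub c : c \in `[a, b] -> c \in `]lo, hi[.
    move: aI bI; rewrite !in_itv /= => /andP[lo_a _] /andP[_ b_hi] /andP[ac cb].
    by rewrite (lt_le_trans lo_a ac) (le_lt_trans cb b_hi).
  have cE : {within `[a, b], continuous E}.
    by apply: derivable_within_continuous => c cI; case: (dE _ (sub _ cI)).
  have dE' c : c \in `]a, b[ -> is_derive c 1 E (E' c).
    rewrite in_itv /= => /andP[ac cb]; apply/dE/sub.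
    by rewrite in_itv /= !ltW.
  have [c cI Ec] := MVT ab dE' cE.
  by exists c => //; rewrite in_itv /= in cI.
have step c : c \in `]lo, hi[ -> `|c - x0| <= `|x - x0| ->
    `|E' c * (x - x0)| <= `|x - x0| ^+ k.+1.
  move=> cI cx; rewrite normrM exprSr ler_wpM2r //.
  by apply: (le_trans (IH c cI)); rewrite lerXn2r ?nnegrE.
have [xx0|xx0|->] := ltgtP x x0.
- have [c /andP[xc cx0]] := EI _ _ xI x0I xx0.
  rewrite E0 sub0r => Ex.
  have -> : E x = E' c * (x - x0) by rewrite -[E x]opprK Ex -mulrN opprB.
  apply: step; last by rewrite !ltr0_norm ?subr_lt0 // lerN2 lerD2r ltW.
  move: xI x0I; rewrite !in_itv /= => /andP[lo_x _] /andP[_ x0_hi].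
  by rewrite (lt_trans lo_x xc) (lt_trans cx0 x0_hi).
- have [c /andP[x0c cx]] := EI _ _ x0I xI xx0.
  rewrite E0 subr0 => ->.
  apply: step; last by rewrite !gtr0_norm ?subr_gt0 // lerD2r ltW.
  move: xI x0I; rewrite !in_itv /= => /andP[_ x_hi] /andP[lo_x0 _].
  by rewrite (lt_trans lo_x0 x0c) (lt_trans cx x_hi).
- by rewrite E0 normr0 exprn_ge0.
Qed.

(** * Polynomial approximations of bounded complexity *)

Definition monom (A : comNzRingType) m (u : 'rV[A]_m) (e : 'I_m -> nat) : A :=
  \prod_i u 0 i ^+ e i.

Section Jets.
Variables (R : realType) (m : nat).
Implicit Types (u t a : 'rV[R]_m) (S : set 'rV[R]_m) (g : 'rV[R]_m -> R).

(** Polynomial approximation to order k around a, on S: both the coefficients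
    and the error, in units of r^k, are controlled by the same constant K. The
    exponents range over the box [0, k)^m rather than over the simplex of total
    degree < k; the box has exactly k^m elements, and its monomials of degree
    at least k are of the size of the error. *)
Definition jet k (K r : R) a S g :=
  exists c : {ffun 'I_m -> 'I_k} -> R, (forall alpha, `|c alpha| <= K) /\
    forall t, S t ->
      `|g t - \sum_alpha c alpha * monom (t - a) (fun i => alpha i : nat)| <= K * r ^+ k.

Lemma monomD u e1 e2 :
  monom u (fun i => e1 i + e2 i)%N = monom u e1 * monom u e2.
Proof. by rewrite /monom -big_split; apply: eq_bigr => i _; rewrite exprD. Qed.

Lemma norm_monom_le1 u e : (forall i, `|u 0 i| <= 1) -> `|monom u e| <= 1.
Proof.
move=> u1; rewrite /monom normr_prod; apply: prodr_ile1 => i _.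
by rewrite normrX exprn_ge0 //= exprn_ile1.
Qed.

Lemma norm_monom_small u e (r : R) k i : r <= 1 ->
  (forall i, `|u 0 i| <= r) -> (k <= e i)%N -> `|monom u e| <= r ^+ k.
Proof.
move=> r1 ur ki; have r0 : 0 <= r by apply: le_trans (ur i).
rewrite /monom (bigD1 i) //= normrM -[leRHS]mulr1.
apply: ler_pM => //.
  rewrite normrX; apply: (@le_trans _ _ (r ^+ e i)).
    by rewrite lerXn2r ?nnegrE.
  exact: ler_wiXn2l.
rewrite normr_prod; apply: prodr_ile1 => q _.
by rewrite normrX exprn_ge0 //= exprn_ile1 // (le_trans (ur q)).
Qed.

(** Terms with equal exponents are gathered, and a term with some exponent at
    least k is O(r^k), so it goes to the error since the displacements are at
    most r <= 1. Thus expansions need not be written over the box from the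
    outset: d and e may be any finite family of terms. *)
Lemma jet_comb k (K err r : R) a S g (B : finType) (d : B -> R)
    (e : B -> 'I_m -> nat) :
  0 <= r <= 1 -> (forall t i, S t -> `|(t - a) 0 i| <= r) -> 0 <= err ->
  \sum_b `|d b| <= K ->
  (forall t, S t -> `|g t - \sum_b d b * monom (t - a) (e b)| <= err * r ^+ k) ->
  jet k (K + err) r a S g.
Proof.
move=> /andP[r0 r1] Sr err0 dK gd.
pose fits b (alpha : {ffun 'I_m -> 'I_k}) := [forall i, e b i == alpha i].
have sub_le (P : pred B) : `|\sum_(b | P b) d b| <= K.
  apply: le_trans dK; rewrite (le_trans (ler_norm_sum _ _ _)) //.
  by rewrite [leRHS](bigID P) /= lerDl sumr_ge0.
exists (fun alpha => \sum_(b | fits b alpha) d b); split.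
  by move=> alpha; rewrite (le_trans (sub_le _)) // lerDl.
move=> t St; set u := t - a.
have ur i : `|u 0 i| <= r by apply: Sr.
pose small b := [forall i, (e b i < k)%N].
have -> : \sum_alpha (\sum_(b | fits b alpha) d b) * monom u (fun i => alpha i : nat) =
    \sum_(b | small b) d b * monom u (e b).
  under eq_bigr do rewrite big_distrl /=.
  (* Each b whose exponents fit in the box contributes to exactly one alpha. *)
  rewrite (exchange_big_dep small) /=; last first.
    by move=> alpha b _ /forallP fb; apply/forallP => i; rewrite (eqP (fb i)).
  apply: eq_bigr => b /forallP sb.
  pose al := [ffun i => Ordinal (sb i)].
  rewrite (big_pred1 al); last first.
    move=> alpha; apply/forallP/eqP => [fb|-> i]; last by rewrite ffunE.
    by apply/ffunP => i; apply/val_inj; rewrite ffunE /= (eqP (fb i)).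
  by congr (_ * _); apply: eq_bigr => i _; rewrite ffunE.
have := gd t St; rewrite -/u => gt.
have -> : g t - \sum_(b | small b) d b * monom u (e b) =
    (g t - \sum_b d b * monom u (e b)) + \sum_(b | ~~ small b) d b * monom u (e b).
  by rewrite [X in _ = _ - X + _](bigID small) /=; ring.
rewrite (le_trans (ler_normD _ _)) // addrC mulrDl lerD //.
rewrite (le_trans (ler_norm_sum _ _ _)) //.
apply: (@le_trans _ _ (\sum_(b | ~~ small b) `|d b| * r ^+ k)).
  apply: ler_sum => b /forallPn[i]; rewrite -leqNgt => ki.
  by rewrite normrM ler_wpM2l // (norm_monom_small _ _ ki).
rewrite -mulr_suml ler_wpM2r ?exprn_ge0 // (le_trans _ dK) //.
by rewrite [leRHS](bigID small) /= lerDr sumr_ge0.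
Qed.

Lemma jet_sum k (K r : R) a S (I : finType) (h : I -> 'rV[R]_m -> R) :
  (forall i, jet k K r a S (h i)) ->
  jet k (#|I|%:R * K) r a S (fun t => \sum_i h i t).
Proof.
move=> H; have [c Hc] := choice H.
exists (fun alpha => \sum_i c i alpha); split.
  move=> alpha; rewrite (le_trans (ler_norm_sum _ _ _)) //.
  rewrite mulr_natl -sumr_const; apply: ler_sum => i _; exact: (Hc i).1.
move=> t St.
under [X in _ - X]eq_bigr do rewrite big_distrl /=.
rewrite exchange_big -sumrB (le_trans (ler_norm_sum _ _ _)) //.
rewrite -mulrA mulr_natl -sumr_const; apply: ler_sum => i _; exact: (Hc i).2.
Qed.

Lemma jet_le k (K K' r : R) a S g : 0 <= r -> K <= K' ->
  jet k K r a S g -> jet k K' r a S g.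
Proof.
move=> r0 KK [c [cK gc]]; exists c; split => [alpha|t St].
  exact: le_trans (cK alpha) KK.
by rewrite (le_trans (gc t St)) // ler_wpM2r // exprn_ge0.
Qed.

Lemma jet_near k (K err r : R) a S g h : 0 <= r -> 0 <= err ->
  (forall t, S t -> `|g t - h t| <= err * r ^+ k) ->
  jet k K r a S h -> jet k (K + err) r a S g.
Proof.
move=> r0 err0 gh [c [cK hc]]; exists c; split => [alpha|t St].
  by rewrite (le_trans (cK alpha)) // lerDl.
rewrite -(subrKA (h t)) (le_trans (ler_normD _ _)) //.
by rewrite mulrDl addrC lerD ?gh ?hc.
Qed.

Lemma jet_norm_le k (K r : R) a S g t : 0 <= r <= 1 ->
  (forall t i, S t -> `|(t - a) 0 i| <= r) -> jet k K r a S g -> S t -> 0 <= K ->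
  `|g t| <= (k ^ m).+1%:R * K.
Proof.
move=> /andP[r0 r1] Sr [c [cK gc]] St K0.
have u1 i : `|(t - a) 0 i| <= 1 by apply: le_trans (Sr t i St) r1.
rewrite -[g t](subrK (\sum_alpha c alpha * monom (t - a) (fun i => alpha i : nat))).
rewrite (le_trans (ler_normD _ _)) // -natr1 mulrDl mul1r addrC lerD //.
  rewrite (le_trans (ler_norm_sum _ _ _)) //.
  have <- : #|{ffun 'I_m -> 'I_k}| = (k ^ m)%N by rewrite card_ffun !card_ord.
  rewrite mulr_natl -sumr_const; apply: ler_sum => al _.
  by rewrite normrM -[K]mulr1 ler_pM // norm_monom_le1.
by rewrite (le_trans (gc t St)) // -[leRHS]mulr1 ler_wpM2l // exprn_ile1.
Qed.

Lemma jet_one k r a S : 0 <= r <= 1 ->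
  (forall t i, S t -> `|(t - a) 0 i| <= r) -> jet k 1 r a S (fun=> 1).
Proof.
move=> r01 Sr; rewrite -[X in jet _ X]addr0.
apply: (@jet_comb _ _ _ _ _ _ _ unit (fun=> 1) (fun _ _ => 0%N)) => //.
  by rewrite sumr_const card_unit normr1.
move=> t St; rewrite sumr_const card_unit mul1r.
by rewrite /monom big1 // subrr normr0 mul0r.
Qed.

(** The product of two expansions is indexed by pairs of exponents, and
    [jet_comb] truncates it. The error comes from
    g h - G H = (g - G) h + G (h - H), where G and H are the two expansions. *)
Lemma jet_mul k (K1 K2 r : R) a S g h : 0 <= r <= 1 ->
  (forall t i, S t -> `|(t - a) 0 i| <= r) -> 0 <= K1 -> 0 <= K2 ->
  jet k K1 r a S g -> jet k K2 r a S h ->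
  jet k (((k ^ m).+1 ^ 2)%:R * K1 * K2) r a S (fun t => g t * h t).
Proof.
move=> r01 Sr K10 K20 Jg Jh.
have /andP[r0 r1] := r01.
have hK := jet_norm_le r01 Sr Jh _ K20.
case: Jg Jh => [c [cK gc]] [d [dK hd]].
pose A := {ffun 'I_m -> 'I_k}.
have cA : #|{: A}| = (k ^ m)%N by rewrite card_ffun !card_ord.
set N := (k ^ m)%N in hK cA *; clearbody N.
have -> : (N.+1 ^ 2)%:R * K1 * K2 = (N ^ 2)%:R * (K1 * K2) + ((2 * N)%:R + 1) * (K1 * K2).
  by rewrite !natrX natrM -(natr1 N); ring.
apply: (@jet_comb _ _ _ _ _ _ _ (A * A)%type (fun p => c p.1 * d p.2)
  (fun p i => p.1 i + p.2 i)%N) => //.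
- by rewrite !mulr_ge0 // addr_ge0.
- have -> : (N ^ 2)%N = #|{: A * A}| by rewrite card_prod cA -mulnn.
  rewrite mulr_natl -sumr_const; apply: ler_sum => p _.
  by rewrite normrM ler_pM.
move=> t St; set u := t - a.
have u1 i : `|u 0 i| <= 1 by apply: le_trans (Sr t i St) r1.
set G := \sum_alpha c alpha * monom u (fun i => alpha i : nat).
have G_le : `|G| <= N%:R * K1.
  rewrite (le_trans (ler_norm_sum _ _ _)) //.
  rewrite -cA mulr_natl -sumr_const; apply: ler_sum => al _.
  by rewrite normrM -[K1]mulr1 ler_pM // norm_monom_le1.
set H := \sum_alpha d alpha * monom u (fun i => alpha i : nat).
have -> : \sum_(p : A * A) c p.1 * d p.2 * monom u (fun i => p.1 i + p.2 i)%N = G * H.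
  rewrite /G big_distrl /= -(pair_big xpredT xpredT
    (fun x y : A => c x * d y * monom u (fun i => x i + y i)%N)) /=.
  apply: eq_bigr => x _; rewrite big_distrr /=.
  by apply: eq_bigr => y _; rewrite monomD; ring.
have -> : g t * h t - G * H = (g t - G) * h t + G * (h t - H) by ring.
rewrite (le_trans (ler_normD _ _)) // !normrM.
have E1 : `|g t - G| * `|h t| <= (K1 * r ^+ k) * (N.+1%:R * K2).
  by rewrite ler_pM // ?gc ?hK.
have E2 : `|G| * `|h t - H| <= (N%:R * K1) * (K2 * r ^+ k).
  by rewrite ler_pM // hd.
rewrite (le_trans (lerD E1 E2)) // -(natr1 N) natrM le_eqVlt; apply/orP; left.
by apply/eqP; ring.
Qed.

End Jets.

(** * Taylor's formula in several variables *)

Definition upd (R : realType) m (t : 'rV[R]_m) (i : 'I_m) (y : R) : 'rV[R]_m :=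
  \row_j if j == i then y else t 0 j.

Lemma updE (R : realType) m (t : 'rV[R]_m) (i : 'I_m) : upd t i (t 0 i) = t.
Proof. by apply/rowP => j; rewrite mxE; case: eqP => // ->. Qed.

(** Turns the directional derivative along a coordinate axis into the derivative
    of a real function of one variable, to which the one-variable Taylor bound
    applies. *)
Lemma is_derive_upd (R : realType) m n (F : 'rV[R]_m -> 'rV[R]_n) (i : 'I_m)
    (j : 'I_n) (t : 'rV[R]_m) (y : R) :
  derivable F (upd t i y) (delta_mx 0 i) ->
  is_derive y 1 (fun y => F (upd t i y) 0 j) (partial i F (upd t i y) 0 j).
Proof.
move=> dF.
pose G z := F z 0 j.
have dG : derivable G (upd t i y) (delta_mx 0 i) by apply: (derivable_mxP _ _ _).1.
have -> : partial i F (upd t i y) 0 j = 'D_(delta_mx 0 i) G (upd t i y).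
  by rewrite /partial derive_mx // mxE.
have quotE : (fun h : R => h^-1 *: (G (h *: delta_mx 0 i + upd t i y) - G (upd t i y)))
    = (fun h : R => h^-1 *: ((G \o upd t i) (h *: 1 + y) - (G \o upd t i) y)).
  apply/funext => h /=; congr (_ *: (G _ - _)).
  apply/rowP => q; rewrite !mxE /=; case: (q == i) => /=.
    by rewrite [_%:A]mulr1 mulr1.
  by rewrite mulr0 add0r.
split; last by rewrite /derive /= -/(G \o upd t i) quotE.
by move: dG; rewrite /derivable /= quotE.
Qed.

Section Taylor.
Variables (R : realType) (m n : nat).
Implicit Types (f : 'rV[R]_m -> 'rV[R]_n) (a t : 'rV[R]_m).

(** Restriction of [mpartial] to a list of coordinates: the two agree on the full
    enumeration. The last coordinate of the list is differentiated first, which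
    is why the induction below removes coordinates from the end. *)
Definition ipartial (l : seq 'I_m) (alpha : 'I_m -> nat) f :=
  foldr (fun i g => iter (alpha i) (partial i) g) f l.

Lemma eq_ipartial l alpha beta f : {in l, alpha =1 beta} ->
  ipartial l alpha f = ipartial l beta f.
Proof.
elim: l => //= i l IH ab; rewrite IH ?ab ?mem_head // => q ql.
by rewrite ab // inE ql orbT.
Qed.

Lemma ipartial_rcons l i alpha f :
  ipartial (rcons l i) alpha f = ipartial l alpha (iter (alpha i) (partial i) f).
Proof. by rewrite /ipartial foldr_rcons. Qed.

Lemma Ck_iter k p (U : set 'rV[R]_m) f i : (p <= k)%N -> Ck k U f ->
  Ck (k - p) U (iter p (partial i) f).
Proof.
elim: p => [|p IH] pk Cf; first by rewrite subn0.
have := IH (ltnW pk) Cf; rewrite -(subnSK pk) => -[_ /(_ i)[]].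
by [].
Qed.

Lemma Ck_iter_derivable k p (U : set 'rV[R]_m) f i x : (p < k)%N -> Ck k U f ->
  U x -> derivable (iter p (partial i) f) x (delta_mx 0 i).
Proof.
move=> pk /(Ck_iter i (ltnW pk)); rewrite -(subnSK pk) => -[_ /(_ i)[d _]].
exact: d.
Qed.

(** Domain of the expansion in the coordinates of l: it grows from the point a,
    for the empty list, to a full neighbourhood of a in the cube, for the
    enumeration of all coordinates. *)
Definition near_slice (l : seq 'I_m) (r : R) a : set 'rV[R]_m :=
  [set t | ocube t /\ forall i, `|(t - a) 0 i| <= r /\ (i \notin l -> t 0 i = a 0 i)].

Lemma near_slice_ball l r a t i : near_slice l r a t -> `|(t - a) 0 i| <= r.
Proof. by case=> _ /(_ i)[]. Qed.

(** One term of the Taylor formula in the i-th coordinate. The p-th derivative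
    along i has only k - p derivatives left, but the factor (t_i - a_i)^p makes
    up for the loss of precision. Freezing t_i at a_i kills the monomials that
    involve the i-th coordinate, which makes room for the exponent p there. *)
Lemma jet_upd k p (K r : R) a i l (g : 'rV[R]_m -> R) :
  (p <= k)%N -> 0 <= r <= 1 -> 0 <= K -> ocube a -> i \notin l ->
  jet (k - p) K r a (near_slice l r a) g ->
  jet k ((k ^ m).+1%:R * K) r a (near_slice (rcons l i) r a)
    (fun t => g (upd t i (a 0 i)) * (t - a) 0 i ^+ p / p`!%:R).
Proof.
move=> pk r01 K0 oa il [c [cK gc]]; have /andP[r0 r1] := r01.
have p1 : `|(p`!%:R)^-1 : R| <= 1.
  by rewrite normfV normr_nat invf_le1 ?ltr0n ?ler1n fact_gt0.
rewrite -natr1 mulrDl mul1r.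
pose d (b : {ffun 'I_m -> 'I_(k - p)}) := if b i == 0%N :> nat then c b / p`!%:R else 0.
apply: (@jet_comb _ _ _ _ _ _ _ _ _ _ d
  (fun b q => (b q + (q == i) * p)%N)) => //.
- by move=> t q [_ /(_ q)[]].
- have -> : (k ^ m)%:R * K = \sum_(al : {ffun 'I_m -> 'I_k}) K.
    by rewrite sumr_const card_ffun !card_ord mulr_natl.
  have card_le : (#|{ffun 'I_m -> 'I_(k - p)}| <= #|{ffun 'I_m -> 'I_k}|)%N.
    rewrite !card_ffun !card_ord; case: (m) => // m'.
    by rewrite leq_exp2r // leq_subr.
  apply: (@le_trans _ _ (\sum_(al : {ffun 'I_m -> 'I_(k - p)}) K)).
    apply: ler_sum => b _; rewrite /d; case: ifP => _; last by rewrite normr0.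
    by rewrite normrM -[leRHS]mulr1 ler_pM.
  by rewrite !sumr_const -![K *+ _]mulr_natl ler_wpM2r // ler_nat.
move=> t [ot tS].
set t' := upd t i (a 0 i).
have t'S : near_slice l r a t'.
  split=> [q|q]; first by rewrite mxE; case: eqP => [_|_]; [exact: oa | exact: ot].
  rewrite !mxE; case: eqP => [->|/eqP qi]; first by rewrite subrr normr0.
  have [] := tS q; rewrite !mxE => tq tl; split => // ql.
  by apply: tl; rewrite mem_rcons inE negb_or qi.
set s := (t - a) 0 i.
have -> : \sum_b d b * monom (t - a) (fun q => (b q + (q == i) * p)%N) =
    (\sum_b c b * monom (t' - a) (fun q => b q : nat)) * s ^+ p / p`!%:R.
  rewrite !mulr_suml; apply: eq_bigr => b _; rewrite /d.
  rewrite /monom [in RHS](bigD1 i) //= !mxE eqxx subrr expr0n.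
  case: eqP => bi; last by rewrite /= !(mul0r, mulr0).
  rewrite [in LHS](bigD1 i) //= eqxx bi add0n mul1n mul1r -/s.
  have -> : \prod_(q < m | q != i) (t - a) 0 q ^+ (b q + (q == i) * p) =
            \prod_(q < m | q != i) (t' - a) 0 q ^+ b q.
    apply: eq_bigr => q qi; rewrite (negbTE qi) mul0n addn0 !mxE.
    by rewrite (negbTE qi).
  ring.
have -> : r ^+ k = r ^+ (k - p) * r ^+ p by rewrite -exprD subnK.
rewrite -mulrBl -mulrBl normrM normrM mulrA.
rewrite -[leRHS]mulr1 ler_pM // ler_pM ?(gc _ t'S) // normrX.
by rewrite lerXn2r ?nnegrE //; case: (tS i).
Qed.

(** Taylor's formula in one coordinate after the other. Expanding in the last
    coordinate of l first uses the iterated partial derivatives exactly in the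
    order in which they are bounded by hypothesis. The constant has to serve all
    orders k' <= k, because the p-th derivative in the last coordinate is
    expanded to the order k' - p. *)
Lemma jet_taylor (l : seq 'I_m) : uniq l -> forall k : nat,
  exists2 K : R, 0 <= K & forall k', (0 < k' <= k)%N ->
  forall f (j : 'I_n), Ck k' (@ocube R m) f ->
  (forall alpha, (\sum_(i <- l) alpha i <= k')%N ->
     forall x, ocube x -> `|ipartial l alpha f x 0 j| <= 1) ->
  forall a (r : R), ocube a -> 0 <= r <= 1 ->
  jet k' K r a (near_slice l r a) (fun t => f t 0 j).
Proof.
elim/last_ind: l => [_ k|l i IH].
  exists 1 => // k' _ f j _ f1 a r oa r01.
  rewrite -[X in jet _ X]addr0.
  apply: (@jet_comb _ _ _ _ _ _ _ _ _ unit (fun=> f a 0 j) (fun _ _ => 0%N)) => //.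
  - by move=> t i; apply: near_slice_ball.
  - rewrite sumr_const card_unit; apply: (f1 (fun=> 0%N)) => //.
    by rewrite big_nil.
  move=> t [_ ta]; have -> : t = a.
    by apply/rowP => i; apply: (ta i).2.
  rewrite sumr_const card_unit subrr /monom big1 ?mulr1 ?subrr ?normr0 ?mul0r //.
rewrite rcons_uniq => /andP[il ul] k.
have [K K0 HK] := IH ul k.
exists (k%:R * ((k ^ m).+1%:R * K) + 1); first by rewrite addr_ge0 ?mulr_ge0.
move=> k' /andP[k'0 k'k] f j Cf bf a r oa r01.
have /andP[r0 r1] := r01.
pose phi t p y := iter p (partial i) f (upd t i y) 0 j.
have bound_iter p : (p <= k')%N -> forall alpha, (\sum_(q <- l) alpha q <= k' - p)%N ->
    forall x, ocube x -> `|ipartial l alpha (iter p (partial i) f) x 0 j| <= 1.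
  move=> pk alpha al x ox.
  (* The multi-index that adds the order p in the coordinate i. *)
  pose be q := if q == i then p else alpha q.
  have bal : {in l, be =1 alpha}.
    by move=> q ql; rewrite /be; case: eqP => // qi; rewrite -qi ql in il.
  have bei : be i = p by rewrite /be eqxx.
  have := bf be; rewrite ipartial_rcons bei (eq_ipartial _ bal).
  apply => //; rewrite big_rcons /= bei (eq_big_seq _ bal).
  by rewrite -(subnK pk) leq_add2r.
apply: (@jet_near _ _ _ _ _ _ _ _ _
  (fun t => \sum_(p < k') phi t p (a 0 i) * (t - a) 0 i ^+ p / p`!%:R)) => //.
  move=> t [ot ta]; rewrite mul1r.
  have ocu y : y \in `]0, 1[ -> ocube (upd t i y).
    by rewrite in_itv /= => y01 q; rewrite mxE; case: eqP => // _; exact: ot.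
  have := @taylor_bound R 0 1 k' (phi t) _ _ (a 0 i) (t 0 i).
  have -> : f t 0 j = phi t 0%N (t 0 i) by rewrite /phi /= updE.
  rewrite !mxE => H; apply: (le_trans (H _ _ _ _)).
  - move=> p y pk /ocu oy; apply: is_derive_upd.
    exact: Ck_iter_derivable pk Cf oy.
  - move=> y /ocu oy.
    (* With no derivative along l left to take, this bounds the remainder. *)
    have := bound_iter k' (leqnn _) (fun=> 0%N) _ _ oy.
    rewrite big1 // => /(_ isT).
    by have -> : forall h, ipartial l (fun=> 0%N) h = h by elim: (l) => //= q l' ->.
  - by rewrite in_itv /= oa.
  - by rewrite in_itv /= ot.
  by rewrite lerXn2r ?nnegrE //; have [] := ta i; rewrite !mxE.
apply: (@jet_le _ _ _ (#|'I_k'|%:R * ((k' ^ m).+1%:R * K))) => //.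
  rewrite card_ord ler_pM ?ler_nat ?mulr_ge0 // ler_wpM2r // ler_nat ltnS.
  by case: (m) => // m'; rewrite leq_exp2r.
apply: jet_sum => p.
apply: (jet_upd (g := fun t => iter p (partial i) f t 0 j)) => //; first exact: ltnW.
apply: HK => //.
- by rewrite subn_gt0 ltn_ord /= (leq_trans (leq_subr _ _)).
- by apply: Ck_iter => //; apply: ltnW.
- by apply: bound_iter; apply: ltnW.
Qed.

End Taylor.

(** * Small values of linear forms *)

(** Siegel's lemma in the form of the box principle. The (H+1)^|D| vectors with
    entries in [0, H] give values in [-L, L]^A with L = H |D| K. Each of these
    intervals is cut into H^2 parts; as 2|A| <= |D|, there are more vectors
    than boxes, so two vectors have all their values within 2L / H^2 of each
    other, and z is their difference. *)
Lemma small_values_pigeonhole (R : realType) (D A : finType) (c : D -> A -> R)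
    (K : R) (H : nat) :
  0 < K -> (forall v a, `|c v a| <= K) -> (0 < H)%N ->
  (0 < #|A|)%N -> (2 * #|A| <= #|D|)%N ->
  exists z : D -> int, [/\ exists v, z v != 0,
    forall v, `|(z v)%:~R : R| <= H%:R &
    forall a, `|\sum_v (z v)%:~R * c v a| <= 2 * #|D|%:R * K / H%:R].
Proof.
move=> K0 cK H0 A0 AD.
have D0 : (0 < #|D|)%N by apply: leq_trans AD; rewrite muln_gt0.
have HR0 : 0 < H%:R :> R by rewrite ltr0n.
pose L : R := H%:R * #|D|%:R * K.
have L0 : 0 < L by rewrite !mulr_gt0 // ltr0n.
pose form (y : {ffun D -> 'I_H.+1}) a := \sum_v (y v)%:R * c v a.
have form_le y a : `|form y a| <= L.
  rewrite (le_trans (ler_norm_sum _ _ _)) // /L -mulrA mulrCA mulr_natl.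
  rewrite -sumr_const; apply: ler_sum => v _.
  by rewrite normrM normr_nat ler_pM // ler_nat -ltnS.
pose pos y a := (form y a + L) * (H ^ 2)%:R / (2 * L).
have pos_ge0 y a : 0 <= pos y a.
  have := form_le y a; rewrite ler_norml => /andP[lb _].
  have fL : 0 <= form y a + L by lra.
  by apply: divr_ge0; apply: mulr_ge0 => //; exact: ltW.
have pos_le y a : pos y a <= (H ^ 2)%:R.
  have L20 : 0 < 2 * L by apply: mulr_gt0.
  rewrite /pos ler_pdivrMr // mulrC ler_wpM2l // mulr_natl mulr2n lerD2r.
  by have := form_le y a; rewrite ler_norml => /andP[].
(* The largest value of pos is H^2 itself, hence one box more than H^2. *)
pose box y : {ffun A -> 'I_(H ^ 2).+1} := [ffun a => inord (Num.truncn (pos y a))].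
have boxE y a : box y a = Num.truncn (pos y a) :> nat.
  rewrite ffunE inordK // ltnS -(ler_nat R) (le_trans _ (pos_le y a)) //.
  by rewrite truncn_le.
have [y1 [y2 [y12 b12]]] : exists y1 y2, y1 != y2 /\ box y1 = box y2.
  apply: contrapT => noex.
  have /leq_card : injective box.
    move=> y1 y2 b12; apply/eqP; apply: contrapT => /negP y12.
    by apply: noex; exists y1, y2.
  rewrite !card_ffun !card_ord leqNgt => /negP; apply.
  apply: (@leq_trans (H.+1 ^ (2 * #|A|))); last by rewrite leq_exp2l.
  rewrite expnM ltn_exp2r // -addn1 -(addn1 H) sqrnD.
  by rewrite -addnA ltn_add2l muln1 -[X in (X < _)%N]addn0 ltn_add2l muln_gt0.
exists (fun v => (y1 v)%:Z - (y2 v)%:Z); split.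
- have [v yv] : exists v, y1 v != y2 v.
    apply/existsP; rewrite -negb_forall; apply: contra y12 => /forallP e.
    by apply/eqP/ffunP => v; apply/eqP.
  by exists v; rewrite subr_eq0.
- move=> v; rewrite rmorphB /= !pmulrn ler_norml.
  have := ltn_ord (y1 v); have := ltn_ord (y2 v).
  rewrite !ltnS -!(ler_nat R) => h2 h1.
  have h3 : 0 <= (y1 v)%:R :> R by [].
  have h4 : 0 <= (y2 v)%:R :> R by [].
  by apply/andP; split; lra.
move=> a.
have -> : \sum_v ((y1 v)%:Z - (y2 v)%:Z)%:~R * c v a = form y1 a - form y2 a.
  rewrite /form -sumrB; apply: eq_bigr => v _.
  by rewrite rmorphB /= mulrBl.
have /andP[p1 q1] := truncn_itv (pos_ge0 y1 a).
have /andP[p2 q2] := truncn_itv (pos_ge0 y2 a).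
rewrite -boxE b12 boxE -natr1 in p1 q1; rewrite -natr1 in q2.
have dpos : `|pos y1 a - pos y2 a| <= 1 by rewrite ler_norml; apply/andP; split; lra.
have -> : form y1 a - form y2 a = (pos y1 a - pos y2 a) * (2 * L / (H ^ 2)%:R).
  by rewrite /pos natrX; field; rewrite !gt_eqF.
have -> : 2 * #|D|%:R * K / H%:R = 2 * L / (H ^ 2)%:R.
  by rewrite /L natrX; field; rewrite !gt_eqF.
rewrite normrM -[leRHS]mul1r; apply: ler_pM => //.
by rewrite ger0_norm // divr_ge0 // mulr_ge0 ?ltW.
Qed.

(** * Hypersurfaces and rational points *)

(** Distinct monomials are linearly independent, so the polynomial with these
    coefficients is nonzero. *)
Lemma hypersurface_lincomb (R : realType) (n e : nat) (B : finType) (d : B -> R)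
    (ex : B -> 'I_n -> nat) :
  (forall b b', ex b =1 ex b' -> b = b') ->
  (forall b, \sum_i ex b i <= e)%N -> (exists b, d b != 0) ->
  hypersurface e [set x : 'rV[R]_n | \sum_b d b * monom x (ex b) = 0].
Proof.
move=> ex_inj ex_le [b0 db0].
pose mn b : multinom n := Multinom [tuple ex b i | i < n].
pose p : mpoly n R := \sum_b d b *: mpolyX R (mn b).
exists p; split.
- apply/eqP => p0; have : mcoeff (mn b0) p = 0 by rewrite p0 mcoeff0.
  rewrite raddf_sum /= (bigD1 b0) //= big1 ?addr0.
    by rewrite mcoeffZ mcoeffX eqxx mulr1; apply/eqP.
  move=> b bb0; rewrite mcoeffZ mcoeffX; case: eqP => [E|_]; last by rewrite mulr0.
  case/eqP: bb0; apply: ex_inj => i.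
  by rewrite -[LHS](mnmE (ex b)) -[RHS](mnmE (ex b0)) -/(mn b) E.
- rewrite (leq_trans (msize_sum _ _ _)) //; apply/bigmax_leqP => b _.
  rewrite (leq_trans (msizeZ_le _ _)) // msizeX ltnS mdegE.
  by rewrite (leq_trans _ (ex_le b)) //; apply: leq_sum => i _; rewrite mnmE.
apply/funext => x; rewrite /mkset raddf_sum /=; congr (_ = 0).
apply: eq_bigr => b _; rewrite mevalZ mevalX; congr (_ * _).
by apply: eq_bigr => i _; rewrite mnmE.
Qed.

Lemma height_bound n (q : 'rV[rat]_n) i : (height (q ord0 i) <= vheight q)%N.
Proof. exact: (leq_bigmax (F := fun i => height (q ord0 i))). Qed.

(** The Liouville inequality: the product of the s-th powers of the denominators
    of the coordinates is at most H^(ns) and clears the denominator of the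
    value, so the latter times H^(ns) bounds an integer in absolute value. *)
Lemma small_rational_value_eq0 (R : realType) (n s H : nat) (q : 'rV[rat]_n)
    (z : {ffun 'I_n -> 'I_s} -> int) : (vheight q <= H)%N ->
  `|\sum_nu (z nu)%:~R * monom (map_mx (@ratr R) q) (fun i => nu i : nat)| *
     H%:R ^+ (n * s) < 1 ->
  \sum_nu (z nu)%:~R * monom (map_mx (@ratr R) q) (fun i => nu i : nat) = 0.
Proof.
move=> qH.
pose P : rat := \sum_nu (z nu)%:~R * monom q (fun i => nu i : nat).
have -> : \sum_nu (z nu)%:~R * monom (map_mx (@ratr R) q) (fun i => nu i : nat) = ratr P.
  rewrite /P rmorph_sum; apply: eq_bigr => nu _.
  rewrite rmorphM /= ratr_int; congr (_ * _).
  by rewrite /monom rmorph_prod; apply: eq_bigr => i _; rewrite rmorphXn mxE.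
pose den : int := \prod_i denq (q 0 i) ^+ s.
have den_gt0 : 0 < den by apply: prodr_gt0 => i _; rewrite exprn_gt0.
have den_le : den%:~R <= H%:R ^+ (n * s) :> R.
  rewrite mulnC exprM -[X in _ ^+ X]card_ord -prodr_const rmorph_prod.
  apply: ler_prod => i _; rewrite rmorphXn /=; apply/andP; split.
    by rewrite exprn_ge0 // ler0z.
  rewrite lerXn2r ?nnegrE ?ler0z //.
  have -> : denq (q 0 i) = absz (denq (q 0 i)) by rewrite absz_denq.
  rewrite -pmulrn ler_nat (leq_trans _ qH) // (leq_trans _ (height_bound q i)) //.
  exact: leq_maxr.
have Pint : P * den%:~R \is a Num.int.
  rewrite /P mulr_suml; apply: rpred_sum => nu _.
  rewrite -mulrA rpredM ?intr_int // /monom rmorph_prod -big_split /=.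
  apply: rpred_prod => i _; rewrite rmorphXn /=.
  have -> : q 0 i ^+ nu i * (denq (q 0 i))%:~R ^+ s =
      (numq (q 0 i))%:~R ^+ nu i * (denq (q 0 i))%:~R ^+ (s - nu i).
    rewrite numqE exprMn -mulrA -exprD subnKC //; exact: ltnW.
  by rewrite rpredM // rpredX // intr_int.
have /intrP[k kE] := Pint.
have ratrk : ratr P * den%:~R = k%:~R :> R.
  by rewrite -(ratr_int R den) -rmorphM /= kE ratr_int.
move=> small.
have : `|ratr P * den%:~R| < 1 :> R.
  apply: le_lt_trans small; rewrite normrM ler_wpM2l //.
  by rewrite ger0_norm // ler0z ltW.
rewrite ratrk -intr_norm ltrz1 => k1.
have k0 : k = 0 by lia.
move/eqP: ratrk; rewrite k0 mulf_eq0 intr_eq0 (gt_eqF den_gt0) orbF.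
by move/eqP.
Qed.

(** * The auxiliary polynomial on a small cell *)

Lemma norm_coord_le (R : realType) n (x : 'rV[R]_n) j : `|x 0 j| <= `|x|.
Proof.
rewrite [leRHS]/Num.Def.normr /= mx_normrE.
exact: (le_bigmax _ (fun ij : 'I_1 * 'I_n => `|x ij.1 ij.2|) (0, j)).
Qed.

(** A monomial of degree at most N is obtained from 1 by at most N
    multiplications by a coordinate of f, each of which costs a constant
    factor. *)
Lemma jet_monom (R : realType) m n k (K r : R) (a : 'rV[R]_m) S
    (f : 'rV[R]_m -> 'rV[R]_n) (e : 'I_n -> nat) N :
  0 <= r <= 1 -> (forall t i, S t -> `|(t - a) 0 i| <= r) -> 1 <= K ->
  (forall j, jet k K r a S (fun t => f t 0 j)) -> (\sum_j e j <= N)%N ->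
  jet k ((((k ^ m).+1 ^ 2)%:R * K) ^+ N) r a S (fun t => monom (f t) e).
Proof.
move=> r01 Sr K1 Jf eN; have /andP[r0 r1] := r01.
set Q := _ * K.
have K0 : 0 <= K by apply: le_trans K1.
have Q1 : 1 <= Q.
  by rewrite -[1]mulr1 ler_pM // ler1n expn_gt0.
have Q0 : 0 <= Q by apply: le_trans Q1.
apply: (@jet_le _ _ _ (Q ^+ (\sum_j e j))) => //; first exact: ler_weXn2l.
rewrite /monom; elim: (index_enum _) => [|j l IHl].
  rewrite big_nil expr0 (_ : (fun t => _) = fun=> 1); first exact: jet_one.
  by apply/funext => t; rewrite big_nil.
rewrite big_cons (_ : (fun t => _) =
    fun t => f t 0 j ^+ e j * \prod_(i <- l) f t 0 i ^+ e i); last first.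
  by apply/funext => t; rewrite big_cons.
elim: (e j) => [|p IH].
  rewrite add0n (_ : (fun t => _) = fun t => \prod_(i <- l) f t 0 i ^+ e i) //.
  by apply/funext => t; rewrite expr0 mul1r.
rewrite addSn exprS (_ : (fun t => _) =
    fun t => f t 0 j * (f t 0 j ^+ p * \prod_(i <- l) f t 0 i ^+ e i)); last first.
  by apply/funext => t; rewrite exprS mulrA.
by apply: jet_mul => //; rewrite exprn_ge0.
Qed.

(** The auxiliary polynomial on one cell. The smallness hypothesis adds up the
    contributions to P(f(t)) of the k^m Taylor coefficients, made small by the
    pigeonhole principle, and of the s^n error terms, and compares the result
    with the Liouville bound. *)
Lemma cell_relation (R : realType) m n k s (K r : R) (a : 'rV[R]_m) S
    (f : 'rV[R]_m -> 'rV[R]_n) (T H : nat) :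
  0 <= r <= 1 -> (forall t i, S t -> `|(t - a) 0 i| <= r) -> 0 < K ->
  (0 < k)%N -> (2 * k ^ m <= s ^ n)%N -> (0 < H)%N ->
  (forall e : {ffun 'I_n -> 'I_s},
     jet k K r a S (fun t => monom (f t) (fun i => e i : nat))) ->
  ((k ^ m)%:R * (2 * (s ^ n)%:R * K / H%:R) + (s ^ n)%:R * (H%:R * (K * r ^+ k)))
    * T%:R ^+ (n * s) < 1 ->
  exists2 z : {ffun 'I_n -> 'I_s} -> int, (exists e, z e != 0) &
    forall t q, S t -> f t = map_mx (@ratr R) q -> (vheight q <= T)%N ->
      \sum_e (z e)%:~R * monom (f t) (fun i => e i : nat) = 0.
Proof.
move=> /andP[r0 r1] Sr K0 k0 kms H0 Jf small.
have [c Hc] := choice Jf.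
pose A := {ffun 'I_m -> 'I_k}; pose D := {ffun 'I_n -> 'I_s}.
have cA : #|{: A}| = (k ^ m)%N by rewrite card_ffun !card_ord.
have cD : #|{: D}| = (s ^ n)%N by rewrite card_ffun !card_ord.
have [||z [z0 zH zc]] := @small_values_pigeonhole R D A c K H K0 (fun v => (Hc v).1) H0.
- by rewrite cA expn_gt0 k0.
- by rewrite cA cD.
rewrite cD in zc.
exists z => // t q St ftq qT.
rewrite ftq; apply: (small_rational_value_eq0 qT).
apply: le_lt_trans small; rewrite ler_wpM2r ?exprn_ge0 // -ftq.
pose phi (al : A) := monom (t - a) (fun i => al i : nat).
(* P(f(t)) splits into its Taylor polynomial at a and the errors. *)
have -> : \sum_e (z e)%:~R * monom (f t) (fun i => e i : nat) =
    \sum_al (\sum_e (z e)%:~R * c e al) * phi al +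
    \sum_e (z e)%:~R * (monom (f t) (fun i => e i : nat) - \sum_al c e al * phi al).
  under [X in _ = X + _]eq_bigr do rewrite mulr_suml.
  rewrite exchange_big -big_split /=; apply: eq_bigr => e _.
  rewrite mulrBr mulr_sumr addrC -[LHS](subrK (\sum_al (z e)%:~R * (c e al * phi al))).
  by congr (_ + _); apply: eq_bigr => al _; rewrite mulrA.
rewrite (le_trans (ler_normD _ _)) // lerD // (le_trans (ler_norm_sum _ _ _)) //.
- rewrite -cA mulr_natl -sumr_const; apply: ler_sum => al _.
  rewrite normrM -[leRHS]mulr1 ler_pM // /phi norm_monom_le1 // => i.
  exact: le_trans (Sr t i St) r1.
- rewrite -cD mulr_natl -sumr_const; apply: ler_sum => e _.
  by rewrite normrM ler_pM //; apply: (Hc e).2.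
Qed.

(** * Covering the rational points of a parametrized set *)

(** The centers are the points (j + 1/2) / M, so that they lie in the open
    interval (0,1). *)
Lemma in_grid_cell (R : realType) m M (t : 'rV[R]_m) : (0 < M)%N -> ocube t ->
  exists kap : {ffun 'I_m -> 'I_M},
    forall i, `|t 0 i - ((kap i)%:R + 2^-1) / M%:R| <= M%:R^-1.
Proof.
move=> M0 ot; have MR0 : 0 < M%:R :> R by rewrite ltr0n.
have lt i : (Num.truncn (M%:R * t 0%R i) < M)%N.
  have /andP[t0 t1] := ot i.
  rewrite truncn_lt_nat; last by rewrite mulr_ge0 // ltW.
  by rewrite -[ltRHS]mulr1 ltr_pM2l.
exists [ffun i => Ordinal (lt i)] => i; rewrite ffunE /=.
have /andP[t0 t1] := ot i.
have /truncn_itv : 0 <= M%:R * t 0 i by rewrite mulr_ge0 // ltW.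
rewrite -natr1; set x := (Num.truncn _)%:R => /andP[lx ux].
have -> : t 0 i - (x + 2^-1) / M%:R = (M%:R * t 0 i - (x + 2^-1)) / M%:R.
  by field; rewrite gt_eqF.
rewrite normrM [X in _ * X]ger0_norm ?invr_ge0 // -[leRHS]mul1r ler_wpM2r ?invr_ge0 //.
by rewrite ler_norml; apply/andP; split; lra.
Qed.

(** The choice of parameters. With H = C1 T^(ns) the pigeonhole contribution is
    below 1/2. The number M = C2 P of cells per axis, where
    T^(2n/w) < P <= 2 T^(2n/w), makes M^k at least C2 T^(2ns), which puts the
    contribution of the errors below 1/2 as well. *)
Lemma parametrized_cover (R : realType) (n m w : nat) : (0 < w)%N -> (m < n)%N ->
  let s := (2 * w ^ n)%N in let k := (s * w)%N in
  exists c : R, 0 < c /\ forall (e T : nat) (f : 'rV[R]_m -> 'rV[R]_n),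
    (n * s.-1 <= e)%N -> (0 < T)%N -> Ck k (@ocube R m) f ->
    (forall alpha : 'I_m -> nat, (mindex_order alpha <= k)%N ->
       forall a, ocube a -> `|mpartial alpha f a| <= 1) ->
    exists (N : nat) (S : 'I_N -> set 'rV[R]_n),
      [/\ N%:R <= c * T%:R `^ ((2 * n ^ 2)%:R / w%:R),
          forall i, hypersurface e (S i) &
          forall t q, ocube t -> f t = map_mx (@ratr R) q -> (vheight q <= T)%N ->
            exists i, S i (f t)].
Proof.
move=> w0 mn s k.
have n0 : (0 < n)%N by apply: leq_ltn_trans mn.
have s0 : (0 < s)%N by rewrite muln_gt0 expn_gt0 w0.
have k0 : (0 < k)%N by rewrite muln_gt0 s0.
(* 2 k^m <= 2 s^(n-1) w^(n-1) <= s^(n-1) * 2 w^n = s^n *)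
have kms : (2 * k ^ m <= s ^ n)%N.
  apply: (@leq_trans (2 * k ^ n.-1)).
    by rewrite leq_mul2l leq_pexp2l // -ltnS prednK.
  have -> : (s ^ n = 2 * (s ^ n.-1 * w ^ n))%N.
    by rewrite -{1}(prednK n0) expnS {1}/s -mulnA [(w ^ n * _)%N]mulnC.
  by rewrite leq_mul2l expnMn leq_mul2l leq_pexp2l ?leq_pred ?orbT.
have [K0 K00 HK] := @jet_taylor R m n _ (enum_uniq 'I_m) k.
pose K := (((k ^ m).+1 ^ 2)%:R * (K0 + 1)) ^+ (n * s).
have K_gt0 : 0 < K by rewrite exprn_gt0 // mulr_gt0 // ?ltr0n ?expn_gt0 // ltr_wpDl.
pose A := (k ^ m)%N; pose D := (s ^ n)%N.
have A0 : (0 < A)%N by rewrite expn_gt0 k0.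
have D0 : (0 < D)%N by rewrite expn_gt0 s0.
pose C1 := (Num.truncn (4 * A%:R * D%:R * K)).+1.
have C1gt : 4 * A%:R * D%:R * K < C1%:R by exact: truncnS_gt.
pose C2 := (Num.truncn (2 * D%:R * C1%:R * K)).+1.
have C2gt : 2 * D%:R * C1%:R * K < C2%:R by exact: truncnS_gt.
exists ((2 * C2)%:R ^+ n); split; first by rewrite exprn_gt0 // ltr0n.
move=> e T f nse T0 Cf bf.
have TR1 : 1 <= T%:R :> R by rewrite ler1n.
have TR0 : 0 < T%:R :> R by rewrite ltr0n.
pose y : R := T%:R `^ ((2 * n)%:R / w%:R).
have y1 : 1 <= y.
  by rewrite -[1](powRr0 T%:R) ler_powR // divr_ge0.
pose P := (Num.truncn y).+1.
have Pgt : y < P%:R by exact: truncnS_gt.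
have Ple : P%:R <= 2 * y.
  rewrite /P -(natr1 (Num.truncn y)) mulr_natl mulr2n lerD // truncn_le.
  exact: le_trans y1.
have yk : y ^+ k = T%:R ^+ (2 * (n * s)).
  rewrite -powR_mulrn ?powR_ge0 // -powRrM -powR_mulrn ?ler0n //; congr (_ `^ _).
  rewrite /k !natrM; field; by rewrite pnatr_eq0 -lt0n.
pose M := (C2 * P)%N; pose H := (C1 * T ^ (n * s))%N.
have M0 : (0 < M)%N by [].
have MR0 : 0 < M%:R :> R by rewrite ltr0n.
have H0 : (0 < H)%N by rewrite muln_gt0 expn_gt0 T0.
have HR0 : 0 < H%:R :> R by rewrite ltr0n.
pose r : R := M%:R^-1.
have r01 : 0 <= r <= 1 by rewrite invr_ge0 ler0n invf_le1 // ler1n.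
have Mk : C2%:R * T%:R ^+ (2 * (n * s)) <= M%:R ^+ k :> R.
  rewrite /M natrM exprMn -yk ler_pM ?exprn_ge0 //.
  - exact: le_trans y1.
  - by rewrite ler_eXnr // ler1n.
  - by rewrite lerXn2r ?nnegrE ?ltW // (lt_le_trans _ y1).
have small : (A%:R * (2 * D%:R * K / H%:R) + D%:R * (H%:R * (K * r ^+ k)))
    * T%:R ^+ (n * s) < 1.
  set X := T%:R ^+ (n * s) in Mk *.
  have X0 : 0 < X by rewrite exprn_gt0.
  have XX : T%:R ^+ (2 * (n * s)) = X ^+ 2 by rewrite mulnC exprM.
  have HE : H%:R = C1%:R * X by rewrite /H natrM natrX.
  have C10 : 0 < C1%:R :> R by rewrite ltr0n.
  have C20 : 0 < C2%:R :> R by rewrite ltr0n.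
  have p1 : A%:R * (2 * D%:R * K / H%:R) * X < 2^-1.
    have -> : A%:R * (2 * D%:R * K / H%:R) * X = (4 * A%:R * D%:R * K) / C1%:R / 2.
      by rewrite HE; field; rewrite !gt_eqF.
    by rewrite ltr_pdivrMr // mulVf // ltr_pdivrMr // mul1r.
  have p2 : D%:R * (H%:R * (K * r ^+ k)) * X < 2^-1.
    have rk : r ^+ k <= (C2%:R * X ^+ 2)^-1.
      by rewrite /r exprVn lef_pV2 ?posrE ?exprn_gt0 ?mulr_gt0 ?exprn_gt0 // -XX.
    apply: (@le_lt_trans _ _ (D%:R * (H%:R * (K * (C2%:R * X ^+ 2)^-1)) * X)).
      by rewrite ler_wpM2r ?(ltW X0) // ler_wpM2l // ler_wpM2l // ler_wpM2l // ltW.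
    have -> : D%:R * (H%:R * (K * (C2%:R * X ^+ 2)^-1)) * X =
        (2 * D%:R * C1%:R * K) / C2%:R / 2.
      by rewrite HE; field; rewrite !gt_eqF.
    by rewrite ltr_pdivrMr // mulVf // ltr_pdivrMr // mul1r.
  by rewrite mulrDl; lra.
pose center (kap : {ffun 'I_m -> 'I_M}) : 'rV[R]_m :=
  \row_i (((kap i)%:R + 2^-1) / M%:R).
have ocenter kap : ocube (center kap).
  move=> i; rewrite mxE; apply/andP; split.
    by rewrite divr_gt0 // ltr_wpDl.
  rewrite ltr_pdivrMr // mul1r.
  have : (kap i).+1%:R <= M%:R :> R by rewrite ler_nat.
  rewrite -natr1; lra.
pose cell kap := near_slice (enum 'I_m) r (center kap).
have cellP kap : exists z : {ffun 'I_n -> 'I_s} -> int, (exists v, z v != 0) /\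
    forall t q, cell kap t -> f t = map_mx (@ratr R) q -> (vheight q <= T)%N ->
      \sum_v (z v)%:~R * monom (f t) (fun i => v i : nat) = 0.
  have [||z z0 zP] := @cell_relation R m n k s K r (center kap) (cell kap) f T H
      r01 _ K_gt0 k0 kms H0 _ small.
  - by move=> t i; apply: near_slice_ball.
  - move=> v; apply: jet_monom => //.
    + by move=> t i; apply: near_slice_ball.
    + by rewrite lerDr.
    + move=> j; apply: (jet_le (K := K0)); rewrite ?lerDl //; first by case/andP: r01.
      apply: HK => //; first by rewrite k0 leqnn.
      move=> al al_le x ox; apply: (le_trans (norm_coord_le _ _)).
      by apply: bf => //; rewrite /mindex_order -big_enum.
    + rewrite -[n in (_ <= n * _)%N]card_ord -sum_nat_const.
      by apply: leq_sum => j _; apply: ltnW.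
  by exists z.
have [z Hz] := choice cellP.
exists #|{ffun 'I_m -> 'I_M}|, (fun i => [set x : 'rV[R]_n |
   \sum_v (z (enum_val i) v)%:~R * monom x (fun i => v i : nat) = 0]); split.
- rewrite card_ffun !card_ord natrX.
  apply: (@le_trans _ _ (((2 * C2)%:R * y) ^+ m)).
    rewrite lerXn2r ?nnegrE ?mulr_ge0 ?powR_ge0 //.
    have -> : (2 * C2)%:R * y = C2%:R * (2 * y) by rewrite natrM; ring.
    by rewrite /M natrM ler_wpM2l.
  apply: (@le_trans _ _ (((2 * C2)%:R * y) ^+ n)).
    rewrite ler_weXn2l ?(ltnW mn) //.
    by rewrite -[leLHS]mulr1 ler_pM // ler1n muln_gt0.
  rewrite exprMn ler_wpM2l ?exprn_ge0 //.
  rewrite /y -powR_mulrn ?powR_ge0 // -powRrM.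
  by rewrite le_eqVlt; apply/orP; left; apply/eqP; congr (_ `^ _); rewrite !natrM; ring.
- move=> i; apply: (@hypersurface_lincomb R n e _ (fun v => (z (enum_val i) v)%:~R)
    (fun (v : {ffun 'I_n -> 'I_s}) j => v j : nat)).
  + by move=> v v' vv'; apply/ffunP => j; apply/val_inj/vv'.
  + move=> v; apply: leq_trans nse.
    rewrite -[n in (_ <= n * _)%N]card_ord -sum_nat_const.
    by apply: leq_sum => j _; rewrite -ltnS prednK.
  + by have [[v v0] _] := Hz (enum_val i); exists v; rewrite intr_eq0.
- move=> t q ot ftq qT.
  have [kap kapP] := in_grid_cell M0 ot.
  exists (enum_rank kap); rewrite /= enum_rankK.
  apply: (Hz kap).2 ftq qT; split => // i; split.
    by rewrite !mxE; exact: kapP.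
  by rewrite mem_enum.
Qed.

(** Covers all rational points of bounded height by the values of their first
    coordinate; this serves the degrees e that are too small for the main
    argument. *)
Lemma hyperplanes_cover (R : realType) (n e T : nat) :
  (0 < n)%N -> (0 < e)%N -> (0 < T)%N ->
  exists (N : nat) (S : 'I_N -> set 'rV[R]_n),
    [/\ N%:R <= 6 * T%:R `^ 2 :> R, forall i, hypersurface e (S i) &
        forall q, (vheight q <= T)%N -> exists i, S i (map_mx (@ratr R) q)].
Proof.
move=> n0 e0 T0.
pose i0 := Ordinal n0.
pose I := ('I_(2 * T).+1 * 'I_T.+1)%type.
(* Numerators in [-T, T] are shifted by T to become natural numbers. A zero
   denominator yields the hyperplane x_1 = 0. *)
pose rho (p : I) : R := ((p.1 : nat)%:R - T%:R) / (p.2 : nat)%:R.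
pose d p (b : bool) : R := if b then 1 else - rho p.
pose ex (b : bool) (j : 'I_n) := (b * (j == i0))%N.
exists #|{: I}|, (fun i => [set x : 'rV[R]_n |
  \sum_b d (enum_val i) b * monom x (ex b) = 0]); split.
- rewrite card_prod !card_ord powR_mulrn // -natrX -natrM ler_nat.
  by apply: (@leq_trans ((3 * T) * (2 * T))); [apply: leq_mul|]; lia.
- move=> i; apply: hypersurface_lincomb.
  + move=> b b' /(_ i0); rewrite /ex eqxx !muln1.
    by case: b b' => [] [].
  + move=> b; rewrite (bigD1 i0) //= big1 => [|j /negbTE ji].
      by rewrite /ex eqxx muln1 addn0; case: b.
    by rewrite /ex ji muln0.
  + by exists true; rewrite oner_eq0.
move=> q qT.
have hq : (height (q ord0 i0) <= T)%N by apply: leq_trans qT; apply: height_bound.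
have nq : (absz (numq (q ord0 i0)) <= T)%N by apply: leq_trans hq; apply: leq_maxl.
have dq : (absz (denq (q ord0 i0)) < T.+1)%N by apply: leq_trans hq; apply: leq_maxr.
have aq : (absz (numq (q ord0 i0) + T%:Z)%R < (2 * T).+1)%N by lia.
exists (enum_rank (Ordinal aq, Ordinal dq)); rewrite /= enum_rankK big_bool /d.
have -> : rho (Ordinal aq, Ordinal dq) = ratr (q 0 i0).
  rewrite /rho /= /ratr; congr (_ / _).
    rewrite [X in X - _]pmulrn gez0_abs; last by lia.
    by rewrite rmorphD /= addrK.
  by rewrite pmulrn absz_denq.
have -> : monom (map_mx (@ratr R) q) (ex true) = ratr (q 0 i0).
  rewrite /monom (bigD1 i0) //= big1 ?mulr1 => [|j /negbTE ji].
    by rewrite /ex eqxx mxE.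
  by rewrite /ex ji.
have -> : monom (map_mx (@ratr R) q) (ex false) = 1.
  by rewrite /monom big1.
by rewrite mul1r mulr1; exact: subrr.
Qed.

(** The dimension m of a parametrization may be any number below n, so the
    constants for the various m are added up. *)
Lemma strong_parametrization_cover (R : realType) (n w : nat) : (0 < w)%N ->
  exists2 c : R, 0 < c & forall (e T : nat) (X : set 'rV[R]_n),
    (n * (2 * w ^ n).-1 <= e)%N -> (0 < T)%N ->
    has_strong_parametrization (2 * w ^ n * w) X ->
    exists (N : nat) (S : 'I_N -> set 'rV[R]_n),
      [/\ N%:R <= c * T%:R `^ ((2 * n ^ 2)%:R / w%:R),
          forall i, hypersurface e (S i) &
          forall q, (vheight q <= T)%N -> X (map_mx (@ratr R) q) ->
            exists i, S i (map_mx (@ratr R) q)].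
Proof.
move=> w0.
have /= /choice[c Hc] := fun m : 'I_n => parametrized_cover R w0 (ltn_ord m).
exists (1 + \sum_m c m).
  by rewrite ltr_pwDl // sumr_ge0 // => m _; have [/ltW] := Hc m.
move=> e T X nse T0 [m [f [mn Cf fX bf]]].
have [_ /(_ e T f nse T0 Cf bf)[N [S [NS hS cov]]]] := Hc (Ordinal mn).
exists N, S; split => //.
  apply: le_trans NS _; rewrite ler_wpM2r ?powR_ge0 //.
  rewrite (bigD1 (Ordinal mn)) //= addrCA lerDl addr_ge0 // sumr_ge0 // => i _.
  by have [/ltW] := Hc i.
move=> q qT; rewrite -fX => -[t ot ftq].
by have [i Si] := cov t q ot ftq qT; exists i; rewrite -ftq.
Qed.

(** The largest w for which the auxiliary polynomials have degree at most e; its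
    value is 0 when e < 2n. *)
Definition scale_of n e := \max_(w < e.+1 | (n * (2 * w ^ n) <= e)%N) (w : nat).

Lemma scale_ofP n e : (0 < n)%N -> (n * (2 * scale_of n e ^ n) <= e)%N.
Proof.
move=> n0; rewrite /scale_of.
apply: (big_ind (fun w => (n * (2 * w ^ n) <= e)%N)) => //.
  by rewrite exp0n // !muln0.
by move=> x y; rewrite /maxn; case: ifP.
Qed.

Lemma leq_scale_of n e w : (0 < n)%N -> (n * (2 * w ^ n) <= e)%N ->
  (w <= scale_of n e)%N.
Proof.
move=> n0 we.
have we1 : (w < e.+1)%N.
  rewrite ltnS (leq_trans _ we) // mulnA (leq_trans _ (leq_pmull _ _)) ?muln_gt0 ?n0 //.
  by case: w we => // w _; rewrite -[X in (X <= _)%N]expn1 leq_pexp2l.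
exact: (leq_bigmax_cond (F := fun w : 'I_e.+1 => w : nat) (Ordinal we1)).
Qed.

Theorem theorem1p2 (R : realType) (n : nat) (hn : (1 <= n)%N) :
  exists (k : nat -> nat) (eps c : nat -> R),
    (forall e : nat, (1 <= e)%N ->
       [/\ (1 <= k e)%N, 0 < eps e, 0 < c e &
           forall X : set 'rV[R]_n, has_strong_parametrization (k e) X ->
           forall T : R, 1 <= T ->
             exists (N : nat) (S : 'I_N -> set 'rV[R]_n),
               [/\ N%:R <= c e * T `^ eps e,
                   forall i, hypersurface e (S i) &
                   ratpoints X T `<=` \bigcup_(i in [set: 'I_N]) S i]])
    /\ eps @ \oo --> (0 : R).
Proof.
have H w : exists c : R, 0 < c /\ ((0 < w)%N -> forall (e T : nat) (X : set 'rV[R]_n),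
    (n * (2 * w ^ n).-1 <= e)%N -> (0 < T)%N ->
    has_strong_parametrization (2 * w ^ n * w) X ->
    exists (N : nat) (S : 'I_N -> set 'rV[R]_n),
      [/\ N%:R <= c * T%:R `^ ((2 * n ^ 2)%:R / w%:R),
          forall i, hypersurface e (S i) &
          forall q, (vheight q <= T)%N -> X (map_mx (@ratr R) q) ->
            exists i, S i (map_mx (@ratr R) q)]).
  have [w0|w0] := posnP w; first by exists 1; rewrite w0.
  by have [c c0 Hc] := strong_parametrization_cover R n w0; exists c.
have [C HC] := choice H.
pose w e := scale_of n e.
exists (fun e => if w e == 0 then 1 else 2 * w e ^ n * w e)%N.
pose eps e : R := if w e == 0%N then 2 else (2 * n ^ 2)%:R / (w e)%:R.
exists eps, (fun e => if w e == 0%N then 6 else C (w e)).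
split; last first.
  apply/cvgr0Pnorm_le => d d0.
  pose M := (Num.truncn ((2 * n ^ 2)%:R / d)).+1.
  exists (n * (2 * M ^ n))%N => // e /= /(leq_scale_of hn) Mw.
  have w0 : (0 < w e)%N by apply: leq_trans Mw.
  rewrite /eps gtn_eqF // ger0_norm ?divr_ge0 //.
  rewrite ler_pdivrMr ?ltr0n // mulrC -ler_pdivrMr //.
  by rewrite (le_trans (ltW (truncnS_gt _))) // ler_nat.
move=> e e1; rewrite /eps; have wP := scale_ofP e hn.
(* Heights are integers, so T may be replaced by its integer part. *)
have transfer (X : set 'rV[R]_n) (T c x : R) : 1 <= T -> 0 <= c -> 0 <= x ->
    (exists (N : nat) (S : 'I_N -> set 'rV[R]_n),
      [/\ N%:R <= c * (Num.truncn T)%:R `^ x, forall i, hypersurface e (S i) &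
          forall q, (vheight q <= Num.truncn T)%N -> X (map_mx (@ratr R) q) ->
            exists i, S i (map_mx (@ratr R) q)]) ->
    exists (N : nat) (S : 'I_N -> set 'rV[R]_n),
      [/\ N%:R <= c * T `^ x, forall i, hypersurface e (S i) &
          ratpoints X T `<=` \bigcup_(i in [set: 'I_N]) S i].
  move=> T1 c0 x0 [N [S [NS hS cov]]].
  have T0 : 0 <= T by apply: le_trans T1.
  exists N, S; split => //.
    rewrite (le_trans NS) // ler_wpM2l // ge0_ler_powR ?nnegrE //.
    by rewrite truncn_le.
  move=> x' [Xx [q [qx qT]]]; rewrite qx in Xx *.
  by have [|i Si] := cov q _ Xx; [rewrite truncn_ge_nat | exists i].
have [w0|w0] := eqVneq (w e) 0%N.
  split => // X _ T T1; apply: transfer => //.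
  have [|N [S [NS hS cov]]] := hyperplanes_cover R hn e1 (T := Num.truncn T).
    by rewrite truncn_gt0.
  by exists N, S; split => // q qT _; apply: cov.
rewrite -lt0n in w0.
have [C0 HCw] := HC (w e).
split => //.
- by rewrite muln_gt0 w0 muln_gt0 expn_gt0 w0.
- by rewrite divr_gt0 ?ltr0n // muln_gt0 expn_gt0 hn.
move=> X pX T T1; apply: transfer => //; first exact: ltW.
apply: HCw => //; last by rewrite truncn_gt0.
by apply: leq_trans wP; rewrite leq_mul2l leq_pred orbT.
Qed.
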